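(* Let $\varepsilon>0$, $L>0$, $\widehat{\mathcal U}_0\in\mathbb R$. For $\nu>0$ put $$k(\nu)=\frac{1}{\sqrt{1+\nu}}\,K\!\left(\frac1{1+\nu}\right).$$ For each $\nu>0$ which satisfies both $$\nu+\mathrm{cn}^2\!\left(\sqrt{\varepsilon}\,L\,\sqrt{1+\nu}\;\Big|\;\frac1{1+\nu}\right)=\frac{\widehat{\mathcal U}_0^2}{4\varepsilon} \qquad\text{and}\qquad \frac{\sqrt\varepsilon\,L}{2}<k(\nu)<\sqrt\varepsilon\,L,$$ the ladder with these parameters admits a stable perversion with non-dimensional pseudo-energy $\nu$ and without hard contact. That is, there is a function $\theta:[0,L]\to\mathbb R$ with $$\theta''+2\varepsilon\sin2\theta=0,\qquad\theta'(0)=\theta'(L)=\widehat{\mathcal U}_0,$$ $\theta(L-R)=-\theta(R)$ for all $R\in[0,L]$, $\theta'(R)\ne0$ for all $R\in(0,L)$, $|\theta(L)|<\pi$, and $\frac12\theta'^2-\varepsilon\cos2\theta\equiv\varepsilon(1+2\nu)$, which is a local minimum of the functional $$\mathscr E[\theta]=\int_0^L\tfrac12\big(\theta'(R)-\widehat{\mathcal U}_0\big)^2+\varepsilon\cos2\theta(R)\,\mathrm dR$$ with free endpoint values.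
   Context: $K(m)=\int_0^{\pi/2}\frac{\mathrm d\varphi}{\sqrt{1-m\sin^2\varphi}}$ is the complete elliptic integral of the first kind with parameter $m$. $\mathrm{cn}(u\,|\,m)=\cos\varphi$, where $\varphi$ is determined by $u=F(\varphi|m)=\int_0^\varphi\frac{\mathrm dt}{\sqrt{1-m\sin^2t}}$, is the Jacobi elliptic cosine with parameter $m$. The pseudo-energy $E=\frac12\theta'^2-\varepsilon\cos2\theta$ is constant along solutions of $\theta''+2\varepsilon\sin2\theta=0$, and $\nu=(E/\varepsilon-1)/2$. The scalar $\theta(R)$ is the angle between the tangents of the two flanges of the ladder; hard contact between the flanges is absent when $|\theta(L)|<\pi$. ''Local minimum'' is understood among all nearby $C^1$ functions on $[0,L]$ (nearness in the $C^1$ norm), with no constraint on the values $\theta(0),\theta(L)$. *)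

(* Defs.v *)
From Stdlib Require Import Reals ClassicalEpsilon.
From Coquelicot Require Import Coquelicot.
Open Scope R_scope.

(* Elliptic integrals take the parameter m (the square of the modulus). *)
Definition ellipticF (phi m : R) : R :=
  RInt (fun t => / sqrt (1 - m * sin t ^ 2)) 0 phi.

Definition ellipticK (m : R) : R :=
  RInt (fun phi => / sqrt (1 - m * sin phi ^ 2)) 0 (PI / 2).

(* The amplitude: the solution phi of ellipticF phi m = u.  For 0 <= m < 1 the
   map phi |-> ellipticF phi m is an increasing bijection of R, so that phi
   exists and is unique; for other m the value may be meaningless. *)
Definition jacobi_am (u m : R) : R :=
  epsilon (inhabits 0) (fun phi => ellipticF phi m = u).

Definition jacobi_cn (u m : R) : R := cos (jacobi_am u m).

Definition kfun (nu : R) : R :=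
  1 / sqrt (1 + nu) * ellipticK (1 / (1 + nu)).

(* A function on [0, L] is a function R -> R of which only the values on [0, L]
   are used; D_in takes difference quotients within [0, L], so that derivatives
   at 0 and L are one-sided. *)
Definition segment (L : R) : R -> Prop := fun x => 0 <= x <= L.

Definition derivative_on (L : R) (f df : R -> R) : Prop :=
  forall x, segment L x -> D_in f df (segment L) x.

Definition C1_on (L : R) (f df : R -> R) : Prop :=
  derivative_on L f df /\
  forall x, segment L x -> continue_in df (segment L) x.

(* dtheta stands for the derivative of theta. *)
Definition energy (eps U0 L : R) (theta dtheta : R -> R) : R :=
  RInt (fun x => 1 / 2 * (dtheta x - U0) ^ 2 + eps * cos (2 * theta x)) 0 L.

(* Local minimality in the C^1 norm.  No condition is imposed on the competitor
   phi at 0 and L. *)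
Definition energy_local_min (eps U0 L : R) (theta dtheta : R -> R) : Prop :=
  C1_on L theta dtheta /\
  exists delta, 0 < delta /\
    forall phi dphi : R -> R,
      C1_on L phi dphi ->
      (forall x, segment L x ->
         Rabs (phi x - theta x) < delta /\ Rabs (dphi x - dtheta x) < delta) ->
      energy eps U0 L theta dtheta <= energy eps U0 L phi dphi.

(* Main.v *)
Require Import Defs.
From Stdlib Require Import Reals Lra Psatz ClassicalEpsilon.
From Coquelicot Require Import Coquelicot.
Open Scope R_scope.

(** With [m = 1 / (1 + nu)], the conserved pseudo-energy turns the second-order
    equation into [theta' = c * sqrt (1 - m * sin theta ^ 2)] up to sign, where
    [c ^ 2 = 4 * eps * (1 + nu)].  The solution that vanishes at [L / 2] is
    therefore, with [s] the sign of [U0],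
      [theta x = s * am (c * (x - L / 2) | m)].
    It is odd about [L / 2], its slope never vanishes because [nu > 0], and
    [theta L = s * A] with [A = am (sqrt eps * L * sqrt (1 + nu) | m)].  The
    equation imposed on [nu] says that [theta' L ^ 2 = U0 ^ 2].  Since
    [F (PI / 2) = K] and [F PI = 2 * K] ([ellipticF_PI]), the two inequalities
    for [kfun nu] say that [PI / 2 < A < PI].

    For stability, the first variation vanishes because [theta' = U0] at both
    ends (natural boundary conditions), and twice the second-order part of the
    energy is the quadratic form
      [int h' ^ 2 - 4 * eps * cos (2 * theta) * h ^ 2].
    As [theta'] solves the Jacobi equation and has no zero, the function
    [w = theta'' / theta'] solves the Riccati equation
    [w' + w ^ 2 + 4 * eps * cos (2 * theta) = 0], and the form equals
      [int (h' - w * h) ^ 2 + w L * h L ^ 2 - w 0 * h 0 ^ 2].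
    Here [w L = - 2 * eps * sin (2 * theta L) / theta' L = - w 0] is positive
    because [A] lies in the second quadrant.  A small perturbation of [w] keeps
    the boundary signs and makes the Riccati inequality strict
    ([strict_riccati_supersolution]); the margin absorbs the cubic remainder of
    the cosine, uniformly for small [h] ([local_min_of_riccati]). *)

(** * Functions on a segment *)

Definition clamp (L x : R) : R := Rmax 0 (Rmin x L).

Lemma clamp_segment (L x : R) : 0 < L -> segment L (clamp L x).
Proof.
  intros HL; unfold segment, clamp, Rmax, Rmin.
  repeat destruct Rle_dec; lra.
Qed.

Lemma clamp_id (L x : R) : segment L x -> clamp L x = x.
Proof.
  unfold segment, clamp, Rmax, Rmin; intros H.
  repeat destruct Rle_dec; lra.
Qed.

Lemma clamp_lipschitz (L x y : R) :
  0 < L -> Rabs (clamp L x - clamp L y) <= Rabs (x - y).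
Proof.
  intros HL; unfold clamp, Rmax, Rmin, Rabs.
  repeat destruct Rle_dec; repeat destruct Rcase_abs; lra.
Qed.

Lemma continuous_clamp (L : R) (f : R -> R) :
  0 < L -> (forall x, segment L x -> continue_in f (segment L) x) ->
  forall x, continuous (fun t => f (clamp L t)) x.
Proof.
  intros HL Hf x.
  apply continuity_pt_filterlim.
  intros e He.
  destruct (Hf _ (clamp_segment L x HL) e He) as [d [Hd H]].
  exists d; split; [exact Hd|].
  intros y [_ Hy].
  destruct (Req_dec (clamp L x) (clamp L y)) as [E|E].
  - simpl; unfold Rdist; rewrite E, Rminus_diag, Rabs_R0; exact He.
  - apply H; split; [split; [now apply clamp_segment|exact E]|].
    simpl in *; unfold Rdist in *.
    eapply Rle_lt_trans; [now apply clamp_lipschitz|exact Hy].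
Qed.

Lemma is_derive_clamp (L : R) (f df : R -> R) :
  derivative_on L f df ->
  forall x, 0 < x < L -> is_derive (fun t => f (clamp L t)) x (df x).
Proof.
  intros Hf x Hx.
  apply is_derive_Reals; intros e He.
  assert (Sx : segment L x) by (unfold segment; lra).
  destruct (Hf x Sx e He) as [d [Hd H]].
  assert (Hm : 0 < Rmin d (Rmin x (L - x))) by (repeat apply Rmin_glb_lt; lra).
  exists (mkposreal _ Hm); simpl; intros h Hh0 Hh.
  pose proof (Rmin_l d (Rmin x (L - x))) as M1.
  pose proof (Rmin_r d (Rmin x (L - x))) as M2.
  pose proof (Rmin_l x (L - x)) as M3.
  pose proof (Rmin_r x (L - x)) as M4.
  destruct (Rabs_def2 h (Rmin d (Rmin x (L - x))) Hh) as [B1 B2].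
  assert (Sh : segment L (x + h)) by (unfold segment; lra).
  rewrite (clamp_id L x Sx), (clamp_id L (x + h) Sh).
  specialize (H (x + h)); simpl in H; unfold Rdist in H.
  replace (x + h - x) with h in H by ring.
  apply H; split; [split; [exact Sh|lra]|lra].
Qed.

Lemma derivative_on_of_is_derive (L : R) (f df : R -> R) :
  (forall x, is_derive f x (df x)) -> derivative_on L f df.
Proof.
  intros Hf x _ e He.
  destruct (proj1 (is_derive_Reals f x (df x)) (Hf x) e He) as [d H].
  exists d; split; [apply cond_pos|].
  intros y [[_ Hy] Hd]; simpl in *; unfold Rdist in *.
  specialize (H (y - x)).
  replace (x + (y - x)) with y in H by ring.
  apply H; lra.
Qed.

Lemma ex_RInt_continuous_everywhere (f : R -> R) (a b : R) :
  (forall x, continuous f x) -> ex_RInt f a b.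
Proof.
  intros Cf; apply (@ex_RInt_continuous R_CompleteNormedModule).
  intros; apply Cf.
Qed.

Lemma is_derive_RInt_continuous (f : R -> R) (a x : R) :
  (forall t, continuous f t) -> is_derive (fun y => RInt f a y) x (f x).
Proof.
  intros Cf; apply (is_derive_RInt f _ a x); [|apply Cf].
  apply filter_forall; intros y.
  now apply (@RInt_correct R_CompleteNormedModule), ex_RInt_continuous_everywhere.
Qed.

Lemma is_derive_continuity_pt (f : R -> R) (x l : R) :
  is_derive f x l -> continuity_pt f x.
Proof.
  intros H; apply derivable_continuous_pt; exists l.
  now apply is_derive_Reals.
Qed.

Lemma is_derive_0_eq (f : R -> R) (a b : R) :
  (forall x, is_derive f x 0) -> f a = f b.
Proof.
  intros D; destruct (MVT_gen f a b (fun _ => 0)) as [c [_ E]].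
  - intros x _; apply D.
  - intros x _; eapply is_derive_continuity_pt, D.
  - lra.
Qed.

(** The integral of [df] extended by constants beyond the end points.  Thanks
    to it, every competitor may be taken to be [C^1] on the whole line, and
    one-sided derivatives disappear from the rest of the argument. *)
Lemma C1_extension (L : R) (f df : R -> R) :
  0 < L -> C1_on L f df ->
  exists g dg : R -> R,
    (forall x, is_derive g x (dg x)) /\
    (forall x, continuous dg x) /\
    (forall x, segment L x -> g x = f x /\ dg x = df x).
Proof.
  intros HL [Hf Hdf].
  pose proof (continuous_clamp L df HL Hdf) as Cd.
  set (g := fun x => f 0 + RInt (fun t => df (clamp L t)) 0 x).
  assert (Dg : forall x, is_derive g x (df (clamp L x))).
  { intros x; unfold g.
    evar_last;
      [apply (@is_derive_plus R_AbsRing R_NormedModule);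
       [apply @is_derive_const|
        apply (is_derive_RInt_continuous (fun t => df (clamp L t))), Cd]|].
    apply plus_zero_l. }
  exists g, (fun t => df (clamp L t)).
  split; [exact Dg|split; [exact Cd|]].
  intros x Hx; rewrite (clamp_id L x Hx); split; [|reflexivity].
  assert (Cf : forall y, continuous (fun t => f (clamp L t)) y).
  { apply continuous_clamp; [exact HL|].
    intros y Hy; apply (cont_deriv f df), Hf, Hy. }
  destruct (MVT_gen (fun t => g t - f (clamp L t)) 0 x (fun _ => 0))
    as [c [_ Hc]].
  - rewrite Rmin_left, Rmax_right by apply Hx.
    intros y Hy.
    assert (Hy' : 0 < y < L) by (unfold segment in Hx; lra).
    evar_last; [apply (@is_derive_minus R_AbsRing R_NormedModule);
                [apply Dg|apply is_derive_clamp; [exact Hf|exact Hy']]|].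
    rewrite clamp_id by (unfold segment; lra).
    unfold minus, plus, opp; simpl; ring.
  - intros y _; apply (continuity_pt_minus g (fun t => f (clamp L t))).
    + eapply is_derive_continuity_pt, Dg.
    + apply continuity_pt_filterlim, Cf.
  - rewrite (clamp_id L x Hx), (clamp_id L 0) in Hc by (unfold segment; lra).
    unfold g in Hc at 2; rewrite RInt_point in Hc.
    unfold zero in Hc; simpl in Hc; lra.
Qed.

(** * The elliptic integral and the amplitude *)

(** The delta amplitude, as a function of the amplitude itself. *)
Definition delta_am (m t : R) : R := sqrt (1 - m * sin t ^ 2).

Lemma delta_radicand_bounds (m t : R) :
  0 <= m < 1 -> 0 < 1 - m * sin t ^ 2 <= 1.
Proof.
  intros Hm; pose proof (SIN_bound t).
  assert (0 <= sin t ^ 2 <= 1) by nra.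
  nra.
Qed.

Lemma delta_am_bounds (m t : R) : 0 <= m < 1 -> 0 < delta_am m t <= 1.
Proof.
  intros Hm; pose proof (delta_radicand_bounds m t Hm); unfold delta_am; split.
  - apply sqrt_lt_R0; lra.
  - rewrite <- sqrt_1 at 2; apply sqrt_le_1_alt; lra.
Qed.

Lemma delta_am_sqr (m t : R) :
  0 <= m < 1 -> delta_am m t ^ 2 = 1 - m * sin t ^ 2.
Proof.
  intros Hm; apply pow2_sqrt; pose proof (delta_radicand_bounds m t Hm); lra.
Qed.

Lemma is_derive_delta_am (m t : R) :
  0 <= m < 1 ->
  is_derive (delta_am m) t (- m * sin t * cos t / delta_am m t).
Proof.
  intros Hm; unfold delta_am.
  pose proof (delta_radicand_bounds m t Hm) as B.
  pose proof (delta_am_bounds m t Hm) as B'; unfold delta_am in B'.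
  auto_derive; [simpl in B; lra|].
  simpl in B'; simpl; unfold Rminus in *; field; lra.
Qed.

Lemma continuous_delta_am (m t : R) : 0 <= m < 1 -> continuous (delta_am m) t.
Proof.
  intros Hm; apply (@ex_derive_continuous R_AbsRing R_NormedModule).
  eexists; now apply is_derive_delta_am.
Qed.

Lemma is_derive_ellipticF (m t : R) :
  0 <= m < 1 -> is_derive (fun s => ellipticF s m) t (/ delta_am m t).
Proof.
  intros Hm; unfold ellipticF.
  assert (C : forall s, continuous (fun t => / sqrt (1 - m * sin t ^ 2)) s).
  { intros s; apply (continuous_Rinv_comp (delta_am m));
      [now apply continuous_delta_am|].
    pose proof (delta_am_bounds m s Hm); lra. }
  apply (is_derive_RInt_continuous (fun t => / sqrt (1 - m * sin t ^ 2))), C.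
Qed.

(** All that is needed about [ellipticF] and its inverse follows from this form
    of the mean value theorem: since [0 < delta_am <= 1], the map
    [ellipticF _ m] is increasing and expanding, so it is onto, and its
    inverse is 1-Lipschitz with derivative [delta_am]. *)
Lemma ellipticF_MVT (m a b : R) :
  0 <= m < 1 ->
  exists c, Rmin a b <= c <= Rmax a b /\
    b - a = delta_am m c * (ellipticF b m - ellipticF a m).
Proof.
  intros Hm.
  destruct (MVT_gen (fun s => ellipticF s m) a b (fun c => / delta_am m c))
    as [c [Hc E]].
  - intros x _; now apply is_derive_ellipticF.
  - intros x _; eapply is_derive_continuity_pt; now apply is_derive_ellipticF.
  - exists c; split; [exact Hc|].
    rewrite E; pose proof (delta_am_bounds m c Hm); field; lra.
Qed.

Lemma ellipticF_0 (m : R) : ellipticF 0 m = 0.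
Proof. unfold ellipticF; now rewrite RInt_point. Qed.

Lemma ellipticF_lt (m a b : R) :
  0 <= m < 1 -> (ellipticF a m < ellipticF b m <-> a < b).
Proof.
  intros Hm.
  destruct (ellipticF_MVT m a b Hm) as [c [_ E]].
  pose proof (delta_am_bounds m c Hm).
  split; intros; nra.
Qed.

Lemma ellipticF_inj (m a b : R) :
  0 <= m < 1 -> ellipticF a m = ellipticF b m -> a = b.
Proof.
  intros Hm E.
  destruct (ellipticF_MVT m a b Hm) as [c [_ E']].
  rewrite E in E'; lra.
Qed.

Lemma ellipticF_opp (m a : R) :
  0 <= m < 1 -> ellipticF (- a) m = - ellipticF a m.
Proof.
  intros Hm.
  assert (D : forall x,
    is_derive (fun s => ellipticF s m + ellipticF (- s) m) x 0).
  { intros x.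
    evar_last;
      [apply (@is_derive_plus R_AbsRing R_NormedModule);
       [now apply is_derive_ellipticF|
        apply (is_derive_comp (fun s => ellipticF s m) Ropp);
        [now apply is_derive_ellipticF|
         apply (@is_derive_opp R_AbsRing R_NormedModule), is_derive_id]]|].
    unfold plus, scal, opp, one; simpl; unfold mult; simpl.
    unfold delta_am; rewrite sin_neg.
    replace ((- sin x) ^ 2) with (sin x ^ 2) by ring; ring. }
  pose proof (is_derive_0_eq _ 0 a D) as E; simpl in E.
  rewrite Ropp_0, ellipticF_0 in E; lra.
Qed.

(** The integrand is symmetric about [PI / 2]. *)
Lemma ellipticF_PI (m : R) : 0 <= m < 1 -> ellipticF PI m = 2 * ellipticK m.
Proof.
  intros Hm.
  assert (D : forall x,
    is_derive (fun s => ellipticF s m + ellipticF (PI - s) m) x 0).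
  { intros x.
    evar_last;
      [apply (@is_derive_plus R_AbsRing R_NormedModule);
       [now apply is_derive_ellipticF|
        apply (is_derive_comp (fun s => ellipticF s m) (fun s => PI - s));
        [now apply is_derive_ellipticF|auto_derive; [trivial|reflexivity]]]|].
    unfold plus, scal; simpl; unfold mult; simpl.
    unfold delta_am; rewrite sin_PI_x; ring. }
  pose proof (is_derive_0_eq _ 0 (PI / 2) D) as E; simpl in E.
  rewrite ellipticF_0, Rminus_0_r in E.
  replace (PI - PI / 2) with (PI / 2) in E by field.
  change (ellipticK m) with (ellipticF (PI / 2) m); lra.
Qed.

Lemma ellipticF_surj (m u : R) : 0 <= m < 1 -> exists a, ellipticF a m = u.
Proof.
  intros Hm.
  assert (B : forall a, Rabs a <= Rabs (ellipticF a m)).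
  { intros a.
    destruct (ellipticF_MVT m 0 a Hm) as [c [_ E]].
    rewrite ellipticF_0, !Rminus_0_r in E.
    pose proof (delta_am_bounds m c Hm).
    rewrite E at 1; rewrite Rabs_mult, (Rabs_pos_eq (delta_am m c)) by lra.
    pose proof (Rabs_pos (ellipticF a m)); nra. }
  set (M := Rabs u + 1).
  assert (HM : 0 < M) by (unfold M; pose proof (Rabs_pos u); lra).
  assert (M <= ellipticF M m).
  { pose proof (B M) as BM.
    assert (0 < ellipticF M m).
    { rewrite <- (ellipticF_0 m); now apply ellipticF_lt. }
    rewrite !Rabs_pos_eq in BM by lra; exact BM. }
  destruct (IVT_gen (fun s => ellipticF s m) (- M) M u) as [a [_ Ha]].
  - intros x; eapply is_derive_continuity_pt; now apply is_derive_ellipticF.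
  - rewrite ellipticF_opp by exact Hm.
    rewrite Rmin_left, Rmax_right by lra.
    unfold M in *; pose proof (Rle_abs u); pose proof (Rle_abs (- u)).
    rewrite Rabs_Ropp in *; lra.
  - now exists a.
Qed.

Lemma ellipticF_am (m u : R) : 0 <= m < 1 -> ellipticF (jacobi_am u m) m = u.
Proof.
  intros Hm; unfold jacobi_am.
  apply (epsilon_spec (inhabits 0)), ellipticF_surj, Hm.
Qed.

Lemma jacobi_am_opp (m u : R) :
  0 <= m < 1 -> jacobi_am (- u) m = - jacobi_am u m.
Proof.
  intros Hm; apply (ellipticF_inj m); [exact Hm|].
  now rewrite ellipticF_opp, !ellipticF_am.
Qed.

Lemma is_derive_am (m u : R) :
  0 <= m < 1 ->
  is_derive (fun v => jacobi_am v m) u (delta_am m (jacobi_am u m)).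
Proof.
  intros Hm; apply is_derive_Reals; intros e He.
  pose proof (continuous_delta_am m (jacobi_am u m) Hm) as C.
  apply continuity_pt_filterlim in C.
  destruct (C e He) as [d [Hd HC]].
  exists (mkposreal d Hd); simpl; intros h Hh0 Hh.
  destruct (ellipticF_MVT m (jacobi_am u m) (jacobi_am (u + h) m) Hm)
    as [c [Hc E]].
  rewrite !ellipticF_am in E by exact Hm.
  replace (u + h - u) with h in E by ring.
  rewrite E; replace (delta_am m c * h / h) with (delta_am m c) by now field.
  destruct (Req_dec (jacobi_am u m) c) as [Ec|Ec].
  { rewrite <- Ec, Rminus_diag, Rabs_R0; exact He. }
  apply HC; split; [split; [exact I|exact Ec]|].
  simpl; unfold Rdist; eapply Rle_lt_trans; [|exact Hh].
  apply Rle_trans with (Rabs (jacobi_am (u + h) m - jacobi_am u m)).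
  - revert Hc; unfold Rmin, Rmax, Rabs.
    repeat destruct Rle_dec; repeat destruct Rcase_abs; lra.
  - pose proof (delta_am_bounds m c Hm).
    rewrite E, Rabs_mult, (Rabs_pos_eq (delta_am m c)) by lra.
    pose proof (Rabs_pos h); nra.
Qed.

(** * Local minimality from a Riccati inequality *)

Lemma Rabs_sin_le (x : R) : Rabs (sin x) <= Rabs x.
Proof.
  destruct (MVT_gen sin 0 x cos) as [c [_ E]].
  - intros y _; auto_derive; [trivial|ring].
  - intros y _; apply continuity_sin.
  - rewrite sin_0, !Rminus_0_r in E; rewrite E, Rabs_mult.
    pose proof (COS_bound c).
    assert (Rabs (cos c) <= 1) by (apply Rabs_le; lra).
    pose proof (Rabs_pos x); nra.
Qed.

Lemma sin_remainder (x : R) : Rabs (sin x - x) <= Rabs x ^ 3 / 2.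
Proof.
  destruct (MVT_gen (fun y => sin y - y) 0 x (fun y => cos y - 1))
    as [c [Hc E]].
  - intros y _; auto_derive; [trivial|ring].
  - intros y _; apply continuity_pt_minus;
      [apply continuity_sin|apply continuity_pt_id].
  - rewrite sin_0, !Rminus_0_r in E; rewrite E, Rabs_mult.
    assert (Hcx : Rabs c <= Rabs x).
    { revert Hc; unfold Rmin, Rmax, Rabs.
      repeat destruct Rle_dec; repeat destruct Rcase_abs; lra. }
    assert (Hcos : cos c = 1 - 2 * sin (c / 2) ^ 2).
    { replace c with (2 * (c / 2)) at 1 by field.
      rewrite cos_2a_sin; ring. }
    pose proof (Rabs_sin_le (c / 2)) as Hs.
    assert (Hs2 : sin (c / 2) ^ 2 <= Rabs x ^ 2 / 4).
    { rewrite <- pow2_abs.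
      replace (c / 2) with (c * / 2) in * by reflexivity.
      rewrite Rabs_mult, (Rabs_pos_eq (/ 2)) in Hs by lra.
      pose proof (Rabs_pos (sin (c * / 2))).
      pose proof (Rabs_pos c). nra. }
    assert (Rabs (cos c - 1) <= Rabs x ^ 2 / 2).
    { pose proof (pow2_ge_0 (sin (c / 2))).
      rewrite Hcos; apply Rabs_le; lra. }
    pose proof (Rabs_pos x); pose proof (Rabs_pos (cos c - 1)); nra.
Qed.

(** By the addition formula the left-hand side is
      [cos (2 * a) * (cos (2 * h) - 1 + 2 * h ^ 2)
       - sin (2 * a) * (sin (2 * h) - 2 * h)],
    and [sin_remainder] bounds the two terms by [2 * |h| ^ 3] and
    [4 * |h| ^ 3]. *)
Lemma cos_second_order (a h : R) :
  Rabs h <= 1 ->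
  cos (2 * (a + h)) - cos (2 * a) + 2 * h * sin (2 * a)
    + 2 * h ^ 2 * cos (2 * a) >= - (6 * Rabs h * h ^ 2).
Proof.
  intros Hh.
  replace (2 * (a + h)) with (2 * a + 2 * h) by ring.
  rewrite cos_plus.
  pose proof (sin_remainder (2 * h)) as R2.
  pose proof (sin_remainder h) as R1.
  rewrite Rabs_mult, (Rabs_pos_eq 2) in R2 by lra.
  pose proof (COS_bound (2 * a)); pose proof (SIN_bound (2 * a)).
  pose proof (Rabs_sin_le h) as Hs.
  rewrite <- (pow2_abs h).
  pose proof (Rabs_pos h) as Hp.
  assert (Hc : Rabs (cos (2 * h) - 1 + 2 * h ^ 2) <= 2 * Rabs h ^ 3).
  { rewrite cos_2a_sin.
    replace (1 - 2 * sin h * sin h - 1 + 2 * h ^ 2)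
      with (- 2 * (sin h - h) * (sin h + h)) by ring.
    rewrite !Rabs_mult.
    rewrite (Rabs_left (- 2)) by lra.
    assert (Rabs (sin h + h) <= 2 * Rabs h)
      by (pose proof (Rabs_triang (sin h) h); lra).
    pose proof (Rabs_pos (sin h - h)); pose proof (Rabs_pos (sin h + h)).
    assert (Rabs (sin h - h) * Rabs (sin h + h)
            <= Rabs h ^ 3 / 2 * (2 * Rabs h))
      by (apply Rmult_le_compat; assumption).
    assert (Rabs h ^ 3 * Rabs h <= Rabs h ^ 3 * 1)
      by (apply Rmult_le_compat_l; [apply pow_le|]; assumption).
    lra. }
  assert (P1 : Rabs (cos (2 * a) * (cos (2 * h) - 1 + 2 * h ^ 2))
               <= 1 * (2 * Rabs h ^ 3)).
  { rewrite Rabs_mult; apply Rmult_le_compat;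
      try apply Rabs_pos; [apply Rabs_le; lra|exact Hc]. }
  assert (P2 : Rabs (sin (2 * a) * (sin (2 * h) - 2 * h))
               <= 1 * ((2 * Rabs h) ^ 3 / 2)).
  { rewrite Rabs_mult; apply Rmult_le_compat;
      try apply Rabs_pos; [apply Rabs_le; lra|exact R2]. }
  apply Rabs_le_between in P1; apply Rabs_le_between in P2.
  replace (Rabs h ^ 2) with (h ^ 2) by (symmetry; apply pow2_abs).
  replace (6 * Rabs h * h ^ 2) with (6 * Rabs h ^ 3)
    by (rewrite <- (pow2_abs h); ring).
  nra.
Qed.

(** Comparison of two integrands up to an exact derivative: adding a null
    Lagrangian [dP] to the first only contributes boundary terms. *)
Lemma RInt_ge_primitive (L : R) (f g P dP : R -> R) :
  0 <= L ->
  (forall x, continuous f x) -> (forall x, continuous g x) ->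
  (forall x, 0 <= x <= L -> is_derive P x (dP x)) ->
  (forall x, 0 <= x <= L -> f x + dP x <= g x) ->
  RInt f 0 L + (P L - P 0) <= RInt g 0 L.
Proof.
  intros HL Cf Cg DP Hle.
  assert (D : forall x, 0 <= x <= L ->
    is_derive (fun t => RInt g 0 t - RInt f 0 t - P t) x (g x - f x - dP x)).
  { intros x Hx.
    apply (@is_derive_minus R_AbsRing R_NormedModule); [|now apply DP].
    apply (@is_derive_minus R_AbsRing R_NormedModule).
    - apply (is_derive_RInt_continuous g), Cg.
    - apply (is_derive_RInt_continuous f), Cf. }
  destruct (MVT_gen (fun t => RInt g 0 t - RInt f 0 t - P t) 0 L
              (fun x => g x - f x - dP x)) as [c [Hc E]].
  - rewrite Rmin_left, Rmax_right by lra; intros x Hx; apply D; lra.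
  - rewrite Rmin_left, Rmax_right by lra; intros x Hx.
    eapply is_derive_continuity_pt; now apply D.
  - rewrite Rmin_left, Rmax_right in Hc by lra.
    rewrite !RInt_point in E; unfold zero in E; simpl in E.
    pose proof (Hle c Hc); nra.
Qed.

(** For a competitor [phi] near [th] and [h = phi - th], the energy densities
    differ by at least the derivative of
      [P = (p - U0) * h + W * h ^ 2 / 2].
    Indeed the Euler-Lagrange equation cancels the terms linear in [h], and
    what remains is
      [(h' - W * h) ^ 2 / 2 - (W' + W ^ 2 + 4 * eps * cos (2 * th)) * h ^ 2 / 2]
    minus a cubic remainder at most [6 * eps * |h| * h ^ 2], which is at most
    [eta * h ^ 2 / 2] when [|h| <= eta / (12 * eps)].  The boundary values of
    [P] have the right sign: [p = U0] at both ends kills the first term, and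
    the signs of [W 0] and [W L] settle the second. *)
Lemma local_min_of_riccati (eps U0 L eta : R) (th p W dW : R -> R) :
  0 < eps -> 0 < L -> 0 < eta ->
  (forall x, is_derive th x (p x)) ->
  (forall x, is_derive p x (- (2 * eps * sin (2 * th x)))) ->
  p 0 = U0 -> p L = U0 ->
  (forall x, 0 <= x <= L -> is_derive W x (dW x)) ->
  (forall x, 0 <= x <= L ->
     dW x + W x ^ 2 + 4 * eps * cos (2 * th x) + eta <= 0) ->
  W 0 <= 0 -> 0 <= W L ->
  energy_local_min eps U0 L th p.
Proof.
  intros He HL Heta Dth Dp Hp0 HpL DW HW HW0 HWL.
  assert (Cth : forall x, continuous th x).
  { intros x; eapply continuity_pt_filterlim, is_derive_continuity_pt, Dth. }
  assert (Cp : forall x, continuous p x).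
  { intros x; eapply continuity_pt_filterlim, is_derive_continuity_pt, Dp. }
  split.
  { split; [now apply derivative_on_of_is_derive|].
    intros x Hx.
    eapply cont_deriv; apply derivative_on_of_is_derive; [exact Dp|exact Hx]. }
  exists (Rmin 1 (eta / (12 * eps))); split.
  { apply Rmin_glb_lt; [lra|apply Rdiv_lt_0_compat; lra]. }
  intros phi0 dphi0 Hphi Hnear.
  destruct (C1_extension L phi0 dphi0 HL Hphi) as [phi [dphi [Dphi [Cd Heq]]]].
  assert (Cphi : forall x, continuous phi x).
  { intros x; eapply continuity_pt_filterlim, is_derive_continuity_pt, Dphi. }
  assert (Eext : energy eps U0 L phi0 dphi0 = energy eps U0 L phi dphi).
  { apply RInt_ext; rewrite Rmin_left, Rmax_right by lra; intros x Hx.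
    destruct (Heq x) as [-> ->]; [unfold segment; lra|reflexivity]. }
  rewrite Eext; clear Eext.
  assert (Cint : forall u v : R -> R,
    (forall x, continuous u x) -> (forall x, continuous v x) ->
    forall x, continuous
      (fun x => 1 / 2 * (v x - U0) ^ 2 + eps * cos (2 * u x)) x).
  { intros u v Cu Cv x; apply continuity_pt_filterlim.
    assert (Ku : continuity_pt u x) by apply continuity_pt_filterlim, Cu.
    assert (Kv : continuity_pt v x) by apply continuity_pt_filterlim, Cv.
    apply continuity_pt_plus.
    - apply (continuity_pt_comp v (fun y => 1 / 2 * (y - U0) ^ 2)); [exact Kv|].
      apply derivable_continuous_pt; reg.
    - apply (continuity_pt_comp u (fun y => eps * cos (2 * y))); [exact Ku|].
      apply derivable_continuous_pt; reg. }
  set (h := fun x => phi x - th x).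
  set (P := fun x => (p x - U0) * (phi x - th x)
                     + 1 / 2 * W x * (phi x - th x) ^ 2).
  set (dP := fun x => - (2 * eps * sin (2 * th x)) * h x
    + (p x - U0) * (dphi x - p x)
    + 1 / 2 * dW x * h x ^ 2 + W x * h x * (dphi x - p x)).
  assert (Hgap : energy eps U0 L th p + (P L - P 0)
                 <= energy eps U0 L phi dphi).
  { apply (RInt_ge_primitive L _ _ P dP); [lra|now apply Cint|now apply Cint| |].
    - intros x Hx; unfold P; specialize (DW x Hx).
      auto_derive.
      + repeat split; eexists;
          [apply Dp|apply Dphi|apply Dth|apply DW|apply Dphi|apply Dth].
      + rewrite (is_derive_unique (fun y : R => p y) x _ (Dp x)),
          (is_derive_unique (fun y : R => phi y) x _ (Dphi x)),
          (is_derive_unique (fun y : R => th y) x _ (Dth x)),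
          (is_derive_unique (fun y : R => W y) x _ DW).
        unfold dP, h; field.
    - intros x Hx.
      destruct (Hnear x Hx) as [Hh _].
      destruct (Heq x Hx) as [Ephi _]; rewrite <- Ephi in Hh.
      fold (h x) in Hh.
      pose proof (Rmin_l 1 (eta / (12 * eps))) as M1.
      pose proof (Rmin_r 1 (eta / (12 * eps))) as M2.
      assert (Hh1 : Rabs (h x) <= 1) by lra.
      pose proof (cos_second_order (th x) (h x) Hh1) as HT.
      replace (th x + h x) with (phi x) in HT by (unfold h; ring).
      assert (Hh2 : 12 * eps * Rabs (h x) <= eta).
      { apply Rle_trans with (12 * eps * (eta / (12 * eps))).
        - apply Rmult_le_compat_l; lra.
        - right; field; lra. }
      specialize (HW x Hx).
      pose proof (pow2_ge_0 (h x)) as Hsq.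
      pose proof (pow2_ge_0 ((dphi x - p x) - W x * h x)) as Hsq'.
      unfold dP.
      apply (Rmult_ge_compat_l eps) in HT; [|lra].
      assert (12 * eps * Rabs (h x) * h x ^ 2 <= eta * h x ^ 2)
        by (apply Rmult_le_compat_r; assumption).
      assert ((dW x + W x ^ 2 + 4 * eps * cos (2 * th x) + eta) * h x ^ 2 <= 0)
        by nra.
      nra. }
  assert (0 <= P L - P 0).
  { unfold P; rewrite Hp0, HpL, Rminus_diag.
    pose proof (pow2_ge_0 (phi L - th L)).
    pose proof (pow2_ge_0 (phi 0 - th 0)).
    nra. }
  lra.
Qed.

(** The logarithmic derivative [w = p' / p] of the Jacobi field [p] solves the
    Riccati equation exactly, and [W = w - k * (x - L / 2) / p ^ 2].  The
    correction is chosen as [g = G / p ^ 2] because [g' + 2 * w * g] is then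
    [G' / p ^ 2], so that the first-order effect of the perturbation on the
    Riccati expression is [- k / p ^ 2] and has a sign; the second-order
    effect is at most half of it when [k * L ^ 2 <= 2 * a].  The two other
    bounds on [k] keep the signs of [w] at the ends, where [w] is not zero. *)
Lemma strict_riccati_supersolution (eps L a b : R) (th p : R -> R) :
  0 < eps -> 0 < L -> 0 < a ->
  (forall x, is_derive th x (p x)) ->
  (forall x, is_derive p x (- (2 * eps * sin (2 * th x)))) ->
  (forall x, a <= p x ^ 2 <= b) ->
  0 < p 0 * sin (2 * th 0) -> p L * sin (2 * th L) < 0 ->
  exists (eta : R) (W dW : R -> R), 0 < eta /\
    (forall x, is_derive W x (dW x)) /\
    (forall x, 0 <= x <= L ->
       dW x + W x ^ 2 + 4 * eps * cos (2 * th x) + eta <= 0) /\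
    W 0 <= 0 /\ 0 <= W L.
Proof.
  intros He HL Ha Dth Dp Hp H0 HL'.
  assert (Hb : 0 < b) by (pose proof (Hp 0); lra).
  assert (Hnz : forall x, p x <> 0).
  { intros x E; pose proof (Hp x) as B; rewrite E in B; lra. }
  set (k := Rmin (2 * a / L ^ 2)
              (Rmin (4 * eps * (p 0 * sin (2 * th 0)) / L)
                    (4 * eps * - (p L * sin (2 * th L)) / L))).
  assert (Hk : 0 < k).
  { unfold k; repeat apply Rmin_glb_lt; apply Rdiv_lt_0_compat; nra. }
  assert (Hk1 : k * L ^ 2 <= 2 * a).
  { apply Rle_trans with (2 * a / L ^ 2 * L ^ 2).
    - apply Rmult_le_compat_r; [nra|apply Rmin_l].
    - right; field; lra. }
  assert (Hk2 : k * L <= 4 * eps * (p 0 * sin (2 * th 0))).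
  { apply Rle_trans with (4 * eps * (p 0 * sin (2 * th 0)) / L * L).
    - apply Rmult_le_compat_r; [lra|].
      eapply Rle_trans; [apply Rmin_r|apply Rmin_l].
    - right; field; lra. }
  assert (Hk3 : k * L <= 4 * eps * - (p L * sin (2 * th L))).
  { apply Rle_trans with (4 * eps * - (p L * sin (2 * th L)) / L * L).
    - apply Rmult_le_compat_r; [lra|].
      eapply Rle_trans; [apply Rmin_r|apply Rmin_r].
    - right; field; lra. }
  clearbody k.
  exists (k / (2 * b)).
  exists (fun x => - (2 * eps * sin (2 * th x)) / p x
                   - k * (x - L / 2) / p x ^ 2).
  exists (fun x => - (4 * eps * cos (2 * th x))
    - (2 * eps * sin (2 * th x)) ^ 2 / p x ^ 2
    - k / p x ^ 2
    - 4 * eps * k * (x - L / 2) * sin (2 * th x) / p x ^ 3).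
  split; [apply Rdiv_lt_0_compat; lra|split; [|split; [|split]]].
  - intros x; auto_derive.
    + assert (Ep : ex_derive (fun y : R => p y) x) by (eexists; apply Dp).
      assert (Et : ex_derive (fun y : R => th y) x) by (eexists; apply Dth).
      assert (Hn2 : p x * (p x * 1) <> 0) by (pose proof (Hp x); simpl in *; lra).
      pose proof (Hnz x) as Hn.
      repeat split; assumption.
    + rewrite (is_derive_unique (fun y : R => p y) x _ (Dp x)),
        (is_derive_unique (fun y : R => th y) x _ (Dth x)).
      simpl; field; apply Hnz.
  - intros x Hx.
    pose proof (Hnz x) as Hn.
    assert (E : - (4 * eps * cos (2 * th x))
        - (2 * eps * sin (2 * th x)) ^ 2 / p x ^ 2 - k / p x ^ 2
        - 4 * eps * k * (x - L / 2) * sin (2 * th x) / p x ^ 3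
        + (- (2 * eps * sin (2 * th x)) / p x
           - k * (x - L / 2) / p x ^ 2) ^ 2
        + 4 * eps * cos (2 * th x) + k / (2 * b)
        = k * (/ (2 * b) - / p x ^ 2 * (1 - k * (x - L / 2) ^ 2 * / p x ^ 2))).
    { field; split; lra. }
    rewrite E; clear E.
    pose proof (Hp x) as B.
    set (q := / p x ^ 2).
    assert (Hq : 0 < q) by (apply Rinv_0_lt_compat; lra).
    assert (Hqp : q * p x ^ 2 = 1) by (unfold q; field; exact Hn).
    assert (Hqb : / b <= q) by (apply Rinv_le_contravar; lra).
    rewrite Rinv_mult.
    assert (Hy : (x - L / 2) ^ 2 <= L ^ 2 / 4) by nra.
    assert (Hky : k * (x - L / 2) ^ 2 <= p x ^ 2 / 2) by nra.
    assert (Hky' : k * (x - L / 2) ^ 2 * q <= 1 / 2) by nra.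
    assert (/ 2 * / b <= q * (1 - k * (x - L / 2) ^ 2 * q)) by nra.
    nra.
  - pose proof (Hnz 0) as Hn.
    replace (- (2 * eps * sin (2 * th 0)) / p 0 - k * (0 - L / 2) / p 0 ^ 2)
      with ((k * L - 4 * eps * (p 0 * sin (2 * th 0))) / 2 * / p 0 ^ 2)
      by (field; exact Hn).
    assert (0 < / p 0 ^ 2)
      by (apply Rinv_0_lt_compat; pose proof (Hp 0); lra).
    nra.
  - pose proof (Hnz L) as Hn.
    replace (- (2 * eps * sin (2 * th L)) / p L - k * (L - L / 2) / p L ^ 2)
      with ((4 * eps * - (p L * sin (2 * th L)) - k * L) / 2 * / p L ^ 2)
      by (field; exact Hn).
    assert (0 < / p L ^ 2)
      by (apply Rinv_0_lt_compat; pose proof (Hp L); lra).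
    nra.
Qed.

(** * The perversion *)

Lemma exists_sign (x : R) : exists s, (s = 1 \/ s = - 1) /\ s * Rabs x = x.
Proof.
  unfold Rabs; destruct (Rcase_abs x); [exists (- 1)|exists 1]; split; lra.
Qed.

Theorem mainTheorem4 :
  forall eps L U0 : R, 0 < eps -> 0 < L ->
  forall nu : R, 0 < nu ->
    nu + jacobi_cn (sqrt eps * L * sqrt (1 + nu)) (1 / (1 + nu)) ^ 2
      = U0 ^ 2 / (4 * eps) ->
    sqrt eps * L / 2 < kfun nu < sqrt eps * L ->
    exists theta dtheta ddtheta : R -> R,
      derivative_on L theta dtheta /\
      derivative_on L dtheta ddtheta /\
      (forall x, 0 <= x <= L -> ddtheta x + 2 * eps * sin (2 * theta x) = 0) /\
      dtheta 0 = U0 /\ dtheta L = U0 /\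
      (forall x, 0 <= x <= L -> theta (L - x) = - theta x) /\
      (forall x, 0 < x < L -> dtheta x <> 0) /\
      Rabs (theta L) < PI /\
      (forall x, 0 <= x <= L ->
         1 / 2 * dtheta x ^ 2 - eps * cos (2 * theta x) = eps * (1 + 2 * nu)) /\
      energy_local_min eps U0 L theta dtheta.
Proof.
  intros eps L U0 He HL nu Hnu HU Hk.
  set (m := 1 / (1 + nu)) in *.
  assert (Hm1 : m * (1 + nu) = 1) by (unfold m; field; lra).
  assert (Hm : 0 <= m < 1).
  { assert (0 < m) by (apply Rdiv_lt_0_compat; lra). nra. }
  set (re := sqrt eps) in *.
  assert (Hre : 0 < re) by (apply sqrt_lt_R0; lra).
  assert (Hre2 : re * re = eps) by (apply sqrt_sqrt; lra).
  set (rn := sqrt (1 + nu)) in *.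
  assert (Hrn : 0 < rn) by (apply sqrt_lt_R0; lra).
  assert (Hrn2 : rn * rn = 1 + nu) by (apply sqrt_sqrt; lra).
  set (u := re * L * rn) in *.
  set (A := jacobi_am u m).
  assert (HK : u / 2 < ellipticK m < u).
  { unfold kfun in Hk; fold rn m in Hk.
    replace (ellipticK m) with (rn * (1 / rn * ellipticK m))
      by (field; lra).
    unfold u; split; nra. }
  assert (HA : PI / 2 < A < PI).
  { split; apply (ellipticF_lt m); try exact Hm; unfold A;
      rewrite ellipticF_am by exact Hm.
    - change (ellipticF (PI / 2) m) with (ellipticK m); lra.
    - rewrite ellipticF_PI by exact Hm; lra. }
  destruct (exists_sign U0) as [s [Hs HsU]].
  assert (Hs2 : s * s = 1) by (destruct Hs; nra).
  (* [u = c * L / 2], so that [am L] below is [A]. *)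
  set (c := 2 * re * rn).
  assert (Hc : 0 < c) by (unfold c; nra).
  assert (Hc2 : c * c = 4 * eps * (1 + nu)).
  { unfold c; rewrite <- Hre2, <- Hrn2; ring. }
  set (am := fun x => jacobi_am (c * (x - L / 2)) m).
  set (th := fun x => s * am x).
  set (p := fun x => s * c * delta_am m (am x)).
  assert (Dam : forall x, is_derive am x (c * delta_am m (am x))).
  { intros x; unfold am.
    evar_last;
      [apply (is_derive_comp (fun v => jacobi_am v m) (fun x => c * (x - L / 2)));
       [now apply is_derive_am|auto_derive; [trivial|reflexivity]]|].
    unfold scal; simpl; unfold mult; simpl; ring. }
  assert (Dth : forall x, is_derive th x (p x)).
  { intros x; unfold th, p; rewrite Rmult_assoc.
    apply is_derive_scal, Dam. }
  assert (Hsin : forall x, sin (2 * th x) = s * sin (2 * am x)).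
  { intros x; unfold th.
    destruct Hs as [-> | ->].
    - now rewrite !Rmult_1_l.
    - replace (2 * (- 1 * am x)) with (- (2 * am x)) by ring.
      rewrite sin_neg; ring. }
  assert (Hcos : forall x, cos (2 * th x) = cos (2 * am x)).
  { intros x; unfold th.
    destruct Hs as [-> | ->].
    - now rewrite !Rmult_1_l.
    - replace (2 * (- 1 * am x)) with (- (2 * am x)) by ring.
      apply cos_neg. }
  assert (Dp : forall x, is_derive p x (- (2 * eps * sin (2 * th x)))).
  { intros x; unfold p.
    pose proof (delta_am_bounds m (am x) Hm) as B.
    evar_last;
      [apply is_derive_scal, (is_derive_comp (delta_am m) am);
       [now apply is_derive_delta_am|apply Dam]|].
    unfold scal; simpl; unfold mult; simpl.
    rewrite Hsin, sin_2a.
    transitivity (- s * (c * c) * m * sin (am x) * cos (am x));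
      [field; lra|].
    rewrite Hc2.
    transitivity (- s * 4 * eps * (m * (1 + nu)) * sin (am x) * cos (am x));
      [ring|rewrite Hm1; ring]. }
  assert (Hp2 : forall x, p x ^ 2 = 4 * eps * (nu + cos (am x) ^ 2)).
  { intros x; unfold p.
    replace ((s * c * delta_am m (am x)) ^ 2)
      with (s * s * (c * c) * delta_am m (am x) ^ 2) by ring.
    rewrite delta_am_sqr, Hs2, Hc2 by exact Hm.
    pose proof (sin2_cos2 (am x)) as SC; unfold Rsqr in SC.
    transitivity (4 * eps * (1 + nu - m * (1 + nu) * sin (am x) ^ 2)); [ring|].
    rewrite Hm1; nra. }
  assert (HamL : am L = A).
  { unfold am, A; f_equal; unfold c, u; field. }
  assert (Ham_opp : forall x, am (L - x) = - am x).
  { intros x; unfold am; rewrite <- jacobi_am_opp by exact Hm.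
    f_equal; field. }
  assert (Ham0 : am 0 = - A).
  { rewrite <- HamL, <- Ham_opp; f_equal; ring. }
  assert (HdA : c * delta_am m A = Rabs U0).
  { pose proof (delta_am_bounds m A Hm) as B.
    rewrite <- (Rabs_pos_eq (c * delta_am m A)) by nra.
    apply Rsqr_eq_abs_0; unfold Rsqr.
    pose proof (Hp2 L) as E; unfold p in E; rewrite HamL in E.
    unfold jacobi_cn in HU; fold A in HU.
    rewrite HU in E.
    transitivity (s * s * (c * c * delta_am m A ^ 2)); [rewrite Hs2; ring|].
    transitivity ((s * c * delta_am m A) ^ 2); [ring|rewrite E; field; lra]. }
  assert (HpL : p L = U0).
  { unfold p; rewrite HamL, Rmult_assoc, HdA; exact HsU. }
  assert (Hp0 : p 0 = U0).
  { unfold p; rewrite Ham0, Rmult_assoc.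
    replace (delta_am m (- A)) with (delta_am m A);
      [rewrite HdA; exact HsU|].
    unfold delta_am; rewrite sin_neg; f_equal; ring. }
  (* The sign that makes the end terms of the second variation positive. *)
  assert (HsinA : sin (2 * A) < 0) by (apply sin_lt_0; lra).
  assert (HU0 : 0 < Rabs U0).
  { rewrite <- HdA; pose proof (delta_am_bounds m A Hm); nra. }
  assert (HUs : forall y, U0 * (s * y) = Rabs U0 * y).
  { intros y; rewrite <- HsU at 1.
    transitivity (s * s * (Rabs U0 * y)); [ring|rewrite Hs2; ring]. }
  exists th, p, (fun x => - (2 * eps * sin (2 * th x))).
  split; [now apply derivative_on_of_is_derive|].
  split; [now apply derivative_on_of_is_derive|].
  split; [intros; ring|].
  split; [exact Hp0|split; [exact HpL|]].
  split; [intros x _; unfold th; rewrite Ham_opp; ring|].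
  split.
  { intros x _ E; pose proof (Hp2 x) as E2; rewrite E in E2.
    pose proof (pow2_ge_0 (cos (am x))); nra. }
  split.
  { unfold th; rewrite HamL, Rabs_mult, (Rabs_pos_eq A) by lra.
    assert (Rabs s = 1) as ->; [|lra].
    destruct Hs as [-> | ->]; [apply Rabs_R1|].
    rewrite Rabs_left; lra. }
  split.
  { intros x _; rewrite Hp2, Hcos, cos_2a_cos; field. }
  destruct (strict_riccati_supersolution eps L (4 * eps * nu)
              (4 * eps * (1 + nu)) th p)
    as (eta & W & dW & Heta & DW & HW & HW0 & HWL); auto.
  - nra.
  - intros x; rewrite Hp2.
    pose proof (COS_bound (am x)).
    assert (0 <= cos (am x) ^ 2 <= 1) by nra.
    nra.
  - rewrite Hp0, Hsin, Ham0, HUs.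
    replace (2 * - A) with (- (2 * A)) by ring; rewrite sin_neg; nra.
  - rewrite HpL, Hsin, HamL, HUs; nra.
  - now apply (local_min_of_riccati eps U0 L eta th p W dW).
Qed.
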